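(* Let $n\ge 2$ and let $\mathcal{D}\subseteq\binom{[n]}{2}$. Then $\mathcal{D}^c$ is (the set of bases of) a matroid on $[n]$ if and only if every connected component of the graph $G_{\mathcal{D}}$ is a complete graph.
   Context: $[n]=\{1,\dots,n\}$, $\binom{[n]}{2}$ is the set of 2-element subsets of $[n]$, and $\mathcal{D}^c=\binom{[n]}{2}\setminus\mathcal{D}$. A collection $\mathcal{B}\subseteq\binom{[n]}{2}$ is called a matroid if it satisfies the basis exchange axiom: for all $B_1,B_2\in\mathcal{B}$ and $b_1\in B_1\setminus B_2$ there is $b_2\in B_2\setminus B_1$ with $(B_1\setminus\{b_1\})\cup\{b_2\}\in\mathcal{B}$. Here the empty collection is counted as a (degenerate) matroid. For $\mathcal{D}\subseteq\binom{[n]}{2}$, put $T_{\mathcal{D}}=\{i\in[n] : \{i,j\}\in\mathcal{D}\text{ for all }j\in[n]\setminus\{i\}\}$, and let $G_{\mathcal{D}}$ be the simple graph with vertex set $[n]\setminus T_{\mathcal{D}}$ and edge set $\{\{i,j\}\in\mathcal{D} : i,j\in[n]\setminus T_{\mathcal{D}}\}$. A single vertex is a complete graph. *)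

(* Defs.v *)
From mathcomp Require Import all_boot.
Set Implicit Arguments.
Unset Strict Implicit.
Unset Printing Implicit Defensive.

(* The ground set [n] is rendered as 'I_n = {0, ..., n-1}. *)

Definition pairs (n : nat) : {set {set 'I_n}} :=
  [set B : {set 'I_n} | #|B| == 2].

(* No nonemptiness is required: the empty collection counts as a matroid. *)
Definition is_matroid (n : nat) (B : {set {set 'I_n}}) : Prop :=
  B \subset pairs n /\
  forall B1 B2 : {set 'I_n}, B1 \in B -> B2 \in B ->
  forall b1, b1 \in B1 :\: B2 ->
  exists2 b2, b2 \in B2 :\: B1 & b2 |: (B1 :\ b1) \in B.

Record sgraph (T : finType) := SGraph {
  vertices : {set T};
  edges : {set {set T}};
  edgesP : forall e, e \in edges -> e \subset vertices /\ #|e| = 2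
}.

Definition adj (T : finType) (G : sgraph T) : rel T :=
  fun x y => [set x; y] \in edges G.

(* A component is represented by its vertex set; as a graph it is the subgraph
   induced on that set. *)
Definition components (T : finType) (G : sgraph T) : {set {set T}} :=
  equivalence_partition (connect (adj G)) (vertices G).

(* The subgraph of G induced on C is complete. *)
Definition is_complete (T : finType) (G : sgraph T) (C : {set T}) : Prop :=
  forall x y, x \in C -> y \in C -> x != y -> adj G x y.

Definition T_set (n : nat) (D : {set {set 'I_n}}) : {set 'I_n} :=
  [set i | [forall j, (j != i) ==> ([set i; j] \in D)]].

Lemma G_graph_subproof (n : nat) (D : {set {set 'I_n}}) :
  D \subset pairs n ->
  forall e, e \in [set e in D | e \subset ~: T_set D] ->
  e \subset ~: T_set D /\ #|e| = 2.
Proof.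
move=> /subsetP hD e; rewrite inE => /andP[eD eV]; split=> //.
by apply/eqP; have := hD _ eD; rewrite inE.
Qed.

Definition G_graph (n : nat) (D : {set {set 'I_n}}) (hD : D \subset pairs n) :
  sgraph 'I_n := SGraph (G_graph_subproof hD).

(* Main.v *)
(* Both sides say that membership in D is transitive off T_D: if {x, y} and
   {y, z} lie in D with x, y, z outside T_D and x <> z, then so does {x, z}.
   If this fails, the bases {y, w} (which exists as y is not in T_D) and {x, z}
   violate exchange of w.  Conversely, no element of a basis lies in T_D, so if
   {b, c} and {b, e} were both in D for a basis {c, e}, then {c, e} would be too. *)

Require Import Defs.
From mathcomp Require Import all_boot.

(** The guard [x != z] is essential: edges have two elements, so [adj] is irreflexive, and going
    back and forth along one edge must not force a loop. *)
Definition adj_transitive (T : finType) (G : sgraph T) : Prop :=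
  forall x y z, adj G x y -> adj G y z -> x != z -> adj G x z.

Lemma adj_sym (T : finType) (G : sgraph T) : symmetric (adj G).
Proof. by move=> x y; rewrite /adj setUC. Qed.

Lemma adj_vertices (T : finType) (G : sgraph T) (x y : T) :
  adj G x y -> x \in vertices G /\ y \in vertices G.
Proof.
by case/edgesP=> /subsetP sub _; split; apply: sub; rewrite !inE eqxx ?orbT.
Qed.

Lemma connect_adj_equiv (T : finType) (G : sgraph T) :
  equivalence_rel (connect (adj G)).
Proof.
have sym := sym_connect_sym (adj_sym T G).
move=> x y z; split=> [|xy]; first exact: connect0.
exact: same_connect.
Qed.

(** Induction on the path from its far end: the last vertex but one is [x] itself or, by induction,
    a neighbour of [x], and transitivity absorbs the final edge. *)
Lemma connect_adj_transitive (T : finType) (G : sgraph T) (x y : T) :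
  adj_transitive T G -> connect (adj G) x y -> x != y -> adj G x y.
Proof.
move=> tr /connectP[p pth ->]; elim/last_ind: p pth => [|p z IH] /=.
  by rewrite eqxx.
rewrite rcons_path last_rcons => /andP[/IH {}IH lz] xz.
by have [xl|/IH xl] := eqVneq x (last x p); [rewrite xl | apply: tr xl lz xz].
Qed.

Lemma components_complete_iff (T : finType) (G : sgraph T) :
  (forall C, C \in components G -> is_complete G C) <-> adj_transitive T G.
Proof.
split=> [compl x y z xy yz xz | tr C /imsetP[r _ ->] x y].
  have [xV _] := adj_vertices _ _ _ _ xy; have [_ zV] := adj_vertices _ _ _ _ yz.
  apply: (compl [set u in vertices G | connect (adj G) x u]) xz.
  - by apply/imsetP; exists x.
  - by rewrite inE xV connect0.
  - by rewrite inE zV (connect_trans (connect1 xy) (connect1 yz)).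
rewrite !inE => /andP[_ rx] /andP[_ ry]; apply: connect_adj_transitive tr _.
by have [_ /(_ rx) <-] := connect_adj_equiv T G r x y.
Qed.

Lemma pairs_set2 (n : nat) (x y : 'I_n) : ([set x; y] \in pairs n) = (x != y).
Proof. by rewrite inE cards2; case: (x != y). Qed.

Lemma pairs_memP (n : nat) (B : {set 'I_n}) (a : 'I_n) :
  B \in pairs n -> a \in B -> exists2 b, a != b & B = [set a; b].
Proof.
rewrite inE => /cards2P[x [y [xy ->]]]; rewrite !inE => /orP[] /eqP->.
  by exists y.
by exists x; rewrite 1?eq_sym // setUC.
Qed.

Lemma notin_T_setP (n : nat) (D : {set {set 'I_n}}) (x : 'I_n) :
  reflect (exists2 y, x != y & [set x; y] \notin D) (x \notin T_set D).
Proof.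
rewrite inE negb_forall; apply: (iffP existsP) => [] [y].
  by rewrite negb_imply eq_sym => /andP[]; exists y.
by move=> xy nD; exists y; rewrite negb_imply eq_sym xy.
Qed.

Lemma adj_G_graph (n : nat) (D : {set {set 'I_n}}) (hD : D \subset pairs n)
    (x y : 'I_n) :
  adj (G_graph hD) x y =
    [&& [set x; y] \in D, x \notin T_set D & y \notin T_set D].
Proof. by rewrite /adj [LHS]inE subUset !sub1set !in_setC. Qed.

Lemma matroid_iff_adj_transitive (n : nat) (D : {set {set 'I_n}})
    (hD : D \subset pairs n) :
  is_matroid (pairs n :\: D) <-> adj_transitive _ (G_graph hD).
Proof.
split=> [[_ exch] x y z | tr].
  rewrite !adj_G_graph => /and3P[xyD xT yT] /and3P[yzD _ zT] xz.
  rewrite xT zT !andbT; apply: contraT => xzD.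
  have [w yw ywD] := notin_T_setP _ _ _ yT.
  (* Both [[set x; y]] and [[set y; z]] lie in [D] while [[set y; w]] does not, so [w] is neither
     [x] nor [z] and can be exchanged. *)
  have wx : w != x by apply: contraNneq ywD => ->; rewrite setUC.
  have wz : w != z by apply: contraNneq ywD => ->.
  have [|||b2] := exch [set y; w] [set x; z] _ _ w.
  - by rewrite in_setD pairs_set2 ywD.
  - by rewrite in_setD pairs_set2 xzD.
  - by rewrite !inE (negbTE wx) (negbTE wz) eqxx orbT.
  have -> : [set y; w] :\ w = [set y].
    by rewrite setUC setU1K // inE eq_sym.
  rewrite in_setD in_set2 => /andP[_ /orP[]] /eqP->; rewrite in_setD.
    by rewrite xyD.
  by rewrite setUC yzD.
split=> [|B1 B2]; first exact: subsetDl.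
rewrite !in_setD => /andP[B1D B1p] /andP[B2D B2p] a /setDP[aB1 aB2].
have [b ab defB1] := pairs_memP _ _ _ B1p aB1.
have B1a : B1 :\ a = [set b] by rewrite defB1 setU1K // inE.
(* If the bases share [b], replacing [a] by the other element of [B2] yields [B2] itself. *)
have [bB2|bB2] := boolP (b \in B2).
  have [e be defB2] := pairs_memP _ _ _ B2p bB2.
  exists e; last by rewrite B1a setUC -defB2 inE B2D.
  move: aB2; rewrite defB1 defB2 !inE !negb_or eqxx orbT andbT => /andP[_ ae].
  by rewrite !(eq_sym e) (negbTE ae) (negbTE be).
(* From here [B1] and [B2] are disjoint, so either element of [B2] is a candidate to replace [a]:
   first [c] is tried, then [e]. *)
have cE c : c \in B2 -> b != c by move=> cB2; apply: contraNneq bB2 => ->.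
have cB1 c : c \in B2 -> c \in B2 :\: B1.
  move=> cB2; rewrite in_setD cB2 andbT defB1 in_set2 negb_or eq_sym.
  by rewrite (eq_sym c) cE // andbT; apply: contraNneq aB2 => ->.
have [c cB2] : exists c, c \in B2.
  by apply/set0Pn; rewrite -card_gt0; move: B2p; rewrite inE => /eqP->.
have [e ce defB2] := pairs_memP _ _ _ B2p cB2.
have eB2 : e \in B2 by rewrite defB2 !inE eqxx orbT.
have [cbD|cbD] := boolP ([set c; b] \in D); last first.
  by exists c; rewrite ?cB1 // B1a in_setD cbD pairs_set2 eq_sym cE.
exists e; rewrite ?cB1 // B1a in_setD pairs_set2 eq_sym cE // andbT.
rewrite setUC; apply: contra (B2D) => beD; rewrite defB2.
(* Each of [c], [e], [b] avoids [T_set D], witnessed by its partner in [B2] or [B1]; transitivity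
   through [b] then applies. *)
have cT : c \notin T_set D by apply/notin_T_setP; exists e; rewrite -?defB2.
have eT : e \notin T_set D.
  by apply/notin_T_setP; exists c; rewrite 1?eq_sym // setUC -defB2.
have bT : b \notin T_set D.
  by apply/notin_T_setP; exists a; rewrite 1?eq_sym // setUC -defB1.
have : adj (G_graph hD) c e.
  by apply: (tr c b e) => //; rewrite adj_G_graph ?cbD ?beD bT ?cT ?eT.
by rewrite adj_G_graph => /and3P[].
Qed.

Theorem lemma3p4 (n : nat) (hn : 2 <= n)
    (D : {set {set 'I_n}}) (hD : D \subset pairs n) :
  is_matroid (pairs n :\: D) <->
  (forall C : {set 'I_n}, C \in components (G_graph hD) ->
     is_complete (G_graph hD) C).
Proof.
apply: iff_trans (matroid_iff_adj_transitive _ _ hD) _.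
by apply: iff_sym; apply: components_complete_iff.
Qed.
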